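(* Let $p$ be an odd prime, $c\in\mathbb Z_p$ with $c(c^2+1)\not\equiv0\pmod p$. Then $$2c\sum_{k=(p+1)/2}^{[3p/4]}\binom{4k}{2k}\frac1{(16(c^2+1))^k}\equiv-4c\sum_{k=1}^{[\frac{p+1}4]}\binom{4k-2}{2k-1}\frac1{(16(c^2+1))^k}\equiv\begin{cases}0\pmod p&\text{if }\big(\frac{c^2+1}p\big)=1,\\1\pmod p&\text{if }c\in Q_1(p),\\-1\pmod p&\text{if }c\in Q_3(p).\end{cases}$$
   Context: $[x]$ is the greatest integer $\le x$; $\mathbb Z_p$ is the set of rational numbers whose denominator is not divisible by $p$; $(\frac{\cdot}{p})$ is the Legendre symbol; $i=\sqrt{-1}$. Quartic Jacobi symbol: for a Gaussian prime $\pi\nmid 2$ and a Gaussian integer $\alpha$, $(\frac{\alpha}{\pi})_4$ is the unique element of $\{0,1,i,-1,-i\}$ congruent to $\alpha^{(N\pi-1)/4}$ modulo $\pi$. For an odd rational prime $p$, $(\frac{\alpha}{p})_4=\prod_j(\frac{\alpha}{\pi_j})_4$ where $p=\prod_j\pi_j$ is the factorization into Gaussian primes. For $m,n\in\mathbb Z_p$, $(\frac{m+ni}{p})_4$ is defined as $(\frac{\alpha}{p})_4$ for any Gaussian integer $\alpha\equiv m+ni\pmod p$. For $r=0,1,2,3$, $Q_r(p)=\{c\in\mathbb Z_p:(\frac{c+i}{p})_4=i^r\}$. (When $(\frac{c^2+1}p)=-1$, $c\in Q_1(p)\cup Q_3(p)$.) *)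

(* Defs.v *)
From HB Require Import structures.
From mathcomp Require Import all_boot all_order all_algebra all_field.
Set Implicit Arguments. Unset Strict Implicit. Unset Printing Implicit Defensive.
Import Order.TTheory GRing.Theory Num.Theory.
Local Open Scope ring_scope.

Definition in_Zp (p : nat) (x : rat) : Prop := ~ (p%:Z %| denq x)%Z.
Definition ratcong (p : nat) (x y : rat) : Prop := (p%:Z %| numq (x - y))%Z.
Definition legendre_one (p : nat) (x : rat) : Prop :=
  ~ ratcong p x 0 /\ exists y : int, ratcong p (y%:~R ^+ 2) x.

Definition gauss (x : algC) : Prop := exists a b : int, x = a%:~R + 'i * b%:~R.
Definition gdvd (d x : algC) : Prop := exists q, gauss q /\ x = q * d.
Definition gcong (x y m : algC) : Prop := gdvd m (x - y).
Definition gunit (u : algC) : Prop := gauss u /\ gdvd u 1.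
Definition gprime (q : algC) : Prop :=
  [/\ gauss q, q <> 0, ~ gunit q &
      forall a b, gauss a -> gauss b -> q = a * b -> gunit a \/ gunit b].

(* (alpha / q)_4 = u for a Gaussian prime q not dividing 2:
   u is the element of {0,1,i,-1,-i} congruent to alpha^((Nq-1)/4) mod q. *)
Definition qsym_prime (q alpha u : algC) : Prop :=
  exists N : nat, q * q^* = N%:R /\
    u \in [:: 0; 1; 'i; -1; - 'i] /\ gcong (alpha ^+ ((N - 1) %/ 4)) u q.

(* (alpha / p)_4 = u for an odd rational prime p: p = prod_j q_j is a
   factorization into Gaussian primes and u = prod_j (alpha/q_j)_4.  Each
   entry of s is a pair (q_j, (alpha/q_j)_4). *)
Definition qsym (p : nat) (alpha u : algC) : Prop :=
  exists s : seq (algC * algC),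
    [/\ forall x, x \in s -> gprime x.1 /\ qsym_prime x.1 alpha x.2,
        \prod_(x <- s) x.1 = p%:R & \prod_(x <- s) x.2 = u].

(* c in Q_r(p) : ((c + i)/p)_4 = i^r, computed via a Gaussian integer
   a + b i congruent to c + i modulo p. *)
Definition Qr (p : nat) (r : nat) (c : rat) : Prop :=
  exists a b : int, [/\ ratcong p a%:~R c, ratcong p b%:~R 1 &
    qsym p (a%:~R + 'i * b%:~R) ('i ^+ r)].

(* Main.v *)
Require Import Defs.
From HB Require Import structures.
From mathcomp Require Import all_boot all_order all_algebra all_field.
From mathcomp Require Import zify ring.
Import Order.TTheory GRing.Theory Num.Theory.
Local Open Scope ring_scope.

(** Write p = 2n+1, D = c^2+1, and reduce everything to an algebraic closure K
    of F_p, with t, w in K such that t^2 = -1 and w^2 = D.  Since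
    C(2j,j) = (-4)^j C(n,j) for j <= n, the second sum S satisfies
    2 w^(n+1) S = c ((w+1)^n - (w-1)^n), while C(2p+2j,p+j) = 2 C(2j,j) shows
    that the first one is -D^n S.  If D^n = 1, then (w+1)^n and (w-1)^n are signs
    of product c^(2n) = 1, so S = 0.  If D^n = -1, then Frobenius maps w to -w,
    whence S w^n (w+1)^(n+1) = -c; and 2t(1+w)z = (z+tw)^2 with z = c+t turns
    (w+1)^(n+1) into a Frobenius computation.  What remains of S is w^n, that is
    z^((p^2-1)/4) when p = 3 mod 4 (taking w = z^(n+1)), and
    ((c+t)(c-t))^((p-1)/4) when p = 1 mod 4: both are read off the quartic symbol
    of c+i, which is evaluated by sending i to t. *)

(** * Reduction of rationals into a field of characteristic p *)

(* A relation, as rationals with a denominator vanishing in [K] have no image. *)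
Definition reduces_to (K : fieldType) (x : rat) (y : K) : Prop :=
  exists a b : int, [/\ b%:~R != 0 :> K, x = a%:~R / b%:~R & y = a%:~R / b%:~R].
Arguments reduces_to {K}.

Lemma neq0_of_intr (K : fieldType) (R : numDomainType) (b : int) :
  b%:~R != 0 :> K -> b%:~R != 0 :> R.
Proof. by rewrite intr_eq0; apply: contraNneq => ->. Qed.

Lemma reduces_int (K : fieldType) (a : int) : reduces_to a%:~R (a%:~R : K).
Proof. by exists a, 1; rewrite oner_eq0 !divr1. Qed.

Lemma reduces_nat (K : fieldType) (n : nat) : reduces_to n%:R (n%:R : K).
Proof. exact: (reduces_int K n%:Z). Qed.

Lemma reducesD {K : fieldType} {x x' : rat} {y y' : K} :
  reduces_to x y -> reduces_to x' y' -> reduces_to (x + x') (y + y').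
Proof.
move=> [a [b [b0 -> ->]]] [a' [b' [b'0 -> ->]]].
exists (a * b' + a' * b), (b * b').
have c0 := neq0_of_intr _ rat _ b0; have c'0 := neq0_of_intr _ rat _ b'0.
split; first by rewrite rmorphM mulf_neq0.
- by rewrite !rmorphD !rmorphM addf_div.
- by rewrite !rmorphD !rmorphM addf_div.
Qed.

Lemma reducesN {K : fieldType} {x : rat} {y : K} :
  reduces_to x y -> reduces_to (- x) (- y).
Proof. by move=> [a [b [b0 -> ->]]]; exists (- a), b; rewrite !rmorphN !mulNr. Qed.

Lemma reducesM {K : fieldType} {x x' : rat} {y y' : K} :
  reduces_to x y -> reduces_to x' y' -> reduces_to (x * x') (y * y').
Proof.
move=> [a [b [b0 -> ->]]] [a' [b' [b'0 -> ->]]].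
exists (a * a'), (b * b').
by split; [rewrite rmorphM mulf_neq0 | rewrite !rmorphM mulf_div..].
Qed.

Lemma reducesV {K : fieldType} {x : rat} {y : K} :
  y != 0 -> reduces_to x y -> reduces_to x^-1 y^-1.
Proof.
move=> y0 [a [b [b0 -> y_ab]]]; exists b, a; rewrite !invf_div y_ab invf_div.
by split=> //; move: y0; rewrite y_ab mulf_eq0 negb_or => /andP[].
Qed.

Lemma reducesX {K : fieldType} {x : rat} {y : K} n :
  reduces_to x y -> reduces_to (x ^+ n) (y ^+ n).
Proof.
move=> xy; elim: n => [|n IHn]; first by rewrite !expr0; apply: reduces_nat 1%N.
by rewrite !exprS; apply: reducesM.
Qed.

Lemma reduces_sum {K : fieldType} (m n : nat) {F : nat -> rat} {G : nat -> K} :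
  (forall k, reduces_to (F k) (G k)) ->
  reduces_to (\sum_(m <= k < n) F k) (\sum_(m <= k < n) G k).
Proof.
move=> FG; elim/big_rec2: _ => [|k y x _ IH]; first exact: reduces_nat 0%N.
exact: reducesD.
Qed.

Lemma reduces_inZp (K : fieldType) (p : nat) (x : rat) :
  p \in [pchar K] -> in_Zp p x -> exists y : K, reduces_to x y.
Proof.
move=> pK xZ; exists ((numq x)%:~R / (denq x)%:~R), (numq x), (denq x).
by rewrite divq_num_den -(dvdz_pcharf pK); split=> //; apply/negP.
Qed.

(** Cross-multiplication compares the lowest terms of [x - x'] with a fraction a/b whose denominator
    is nonzero in [K]. If the numerator vanished in [K] but a did not, p would divide the
    denominator too, against coprimality. *)
Lemma ratcong_reduces {K : fieldType} {p : nat} {x x' : rat} {y y' : K} :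
  p \in [pchar K] -> reduces_to x y -> reduces_to x' y' ->
  ratcong p x x' <-> y = y'.
Proof.
move=> pK xy xy'; rewrite /ratcong (dvdz_pcharf pK).
have [a [b [b0 xab yab]]] := reducesD xy (reducesN xy').
have cross : (numq (x - x'))%:~R * b%:~R = a%:~R * (denq (x - x'))%:~R :> K.
  rewrite -!rmorphM; congr _%:~R; apply: (@intr_inj rat).
  rewrite !intrM (numqE (x - x')) mulrAC xab divfK ?xab //.
  exact: (neq0_of_intr _ _ _ b0).
have -> : (y = y') <-> a%:~R = 0 :> K.
  have -> : (y = y') <-> y - y' == 0 by rewrite subr_eq0; split=> /eqP.
  by rewrite yab mulf_eq0 invr_eq0 (negPf b0) orbF; split=> /eqP.
split=> [/eqP num0|a0].
  move/eqP: cross; rewrite num0 mul0r eq_sym mulf_eq0 => /orP[/eqP//|den0].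
  have pn : (p %| gcdz (numq (x - x')) (denq (x - x')))%Z.
    by rewrite dvdz_gcd !(dvdz_pcharf pK) num0 eqxx den0.
  move: pn; rewrite /gcdz (eqP (coprime_num_den _)) (dvdz_pcharf pK).
  by rewrite oner_eq0.
by move/eqP: cross; rewrite a0 mul0r mulf_eq0 (negPf b0) orbF.
Qed.

(** * Frobenius and Fermat's little theorem *)

Lemma exprDp {K : fieldType} {p : nat} (x y : K) :
  p \in [pchar K] -> (x + y) ^+ p = x ^+ p + y ^+ p.
Proof. by move=> pK; rewrite exprDn_pchar // pnatE ?(pcharf_prime pK). Qed.

Lemma exprp_int {K : fieldType} {p : nat} (a : int) :
  p \in [pchar K] -> a%:~R ^+ p = a%:~R :> K.
Proof. by move=> pK; rewrite -(pFrobenius_autE pK) rmorph_int. Qed.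

Lemma exprp_reduces {K : fieldType} {p : nat} {x : rat} {y : K} :
  p \in [pchar K] -> reduces_to x y -> y ^+ p = y.
Proof. by move=> pK [a [b [_ _ ->]]]; rewrite expr_div_n !exprp_int. Qed.

(** Fermat's little theorem for p = 2n+1, split as a product because the quadratic character x^n
    recurs on its own. *)
Lemma expr_pred_p {K : fieldType} {n : nat} (x : K) :
  x ^+ (n.*2.+1) = x -> x != 0 -> x ^+ n * x ^+ n = 1.
Proof.
move=> xp x0; rewrite -exprD addnn; apply: (mulfI x0).
by rewrite -exprS xp mulr1.
Qed.

Lemma natr_lt_pchar {K : fieldType} {p : nat} (j : nat) :
  p \in [pchar K] -> (0 < j < p)%N -> j%:R != 0 :> K.
Proof.
move=> pK /andP[j0 jp]; rewrite -(dvdn_pcharf pK).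
by apply: contraTN jp => /(dvdn_leq j0); rewrite -leqNgt.
Qed.

(** * Binomial coefficients in characteristic p *)

(** Over the rationals C(2j,j) = (-4)^j C(-1/2,j), and n = -1/2 in [K]. The induction compares
    ratios of consecutive terms, 2(2j+1)/(j+1) and -4(n-j)/(j+1), which agree because 2j+1 =
    -2(n-j). *)
Lemma central_bin_pchar {K : fieldType} {n : nat} (j : nat) :
  n.*2.+1 \in [pchar K] -> (j <= n)%N ->
  'C(j.*2, j)%:R = (- 4) ^+ j * 'C(n, j)%:R :> K.
Proof.
move=> pK; elim: j => [|j IHj] jn; first by rewrite !bin0 expr0 mulr1.
have j0 : j.+1%:R != 0 :> K by apply: (natr_lt_pchar _ pK); lia.
apply: (mulfI j0).
have -> : j.+1%:R * 'C(j.+1.*2, j.+1)%:R = (2 * (j.*2.+1))%:R * 'C(j.*2, j)%:R :> K.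
  (* A second factor j+1 turns the claim into an identity of natural numbers that follows from the
     recurrences [e1] to [e4]. *)
  apply: (mulfI j0); rewrite -!natrM; congr _%:R.
  have e1 := mul_bin_diag j.+1.*2 j.
  have e2 := mul_bin_left (j.*2.+1) j.
  have e3 := mul_bin_diag (j.*2.+1) j.
  have e4 := mul_bin_left j.*2 j.
  rewrite doubleS /= in e1 e3 *.
  have e5 : (j.*2.+1 - j = j.+1)%N by lia.
  have e6 : (j.*2 - j = j)%N by lia.
  rewrite e5 in e2; rewrite e6 in e4.
  nia.
rewrite mulrCA -(natrM _ j.+1) mul_bin_left IHj ?(ltnW jn) //.
rewrite (natrM _ (n - j)) natrB ?(ltnW jn) //.
have : n.*2.+1%:R = 0 :> K by apply/eqP; rewrite -(dvdn_pcharf pK).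
rewrite -[j.*2.+1]addn1 -[n.*2.+1]addn1 -!muln2 natrM !natrD !natrM => /eqP.
rewrite addr_eq0 => /eqP n2.
rewrite exprS.
have -> : -4 * (-4) ^+ j * ((n%:R - j%:R) * 'C(n, j)%:R) =
    (-4) ^+ j * ((- 2 * (n%:R * 2%:R) + 4 * j%:R) * 'C(n, j)%:R) :> K by ring.
by rewrite n2; ring.
Qed.

Lemma coef_exprD1 (R : nzRingType) (n k : nat) :
  (('X + 1 : {poly R}) ^+ n)`_k = 'C(n, k)%:R.
Proof.
rewrite exprD1n coef_sum; case: (ltnP k n.+1) => kn.
  rewrite (bigD1 (Ordinal kn)) //= coefMn coefXn eqxx big1 ?addr0 // => i ik.
  rewrite coefMn coefXn -[k]/(val (Ordinal kn)) val_eqE eq_sym (negPf ik).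
  by rewrite mul0rn.
rewrite bin_small // big1 // => i _; rewrite coefMn coefXn.
by rewrite gtn_eqF ?mul0rn // (leq_trans (ltn_ord i)).
Qed.

(** Coefficient of X^k in (X+1)^(p+N) = (X^p+1)(X+1)^N. The test [k < p] is needed because truncated
    subtraction would give k-p = 0 and a spurious 1. *)
Lemma binD_pchar {K : fieldType} {p : nat} (N k : nat) : p \in [pchar K] ->
  'C(p + N, k)%:R = 'C(N, k)%:R + (if (k < p)%N then 0 else 'C(N, k - p)%:R) :> K.
Proof.
move=> pK; rewrite -!coef_exprD1 exprD exprDn_pchar; last first.
  by rewrite pnatE ?(pcharf_prime pK) // (rmorph_pchar (@polyC K)).
by rewrite expr1n mulrDl mul1r coefD coefXnM addrC.
Qed.

(** Removing p twice from the upper index 2p+2j leaves C(2j,p+j) + 2 C(2j,j), and the first term is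
    zero because j < p. *)
Lemma central_bin_shift {K : fieldType} {p : nat} (j : nat) :
  p \in [pchar K] -> (j < p)%N ->
  'C((p + j).*2, p + j)%:R = 2 * 'C(j.*2, j)%:R :> K.
Proof.
move=> pK jp; rewrite doubleD -addnn -addnA (binD_pchar _ _ pK) ltnNge leq_addr /=.
rewrite !(binD_pchar _ _ pK) ltnNge leq_addr /= addKn jp addr0.
by rewrite bin_small ?add0r ?mulr_natl ?mulr2n //; lia.
Qed.

(** The bound N is left free so that one range of indices serves both parities of n; the added
    coefficients are zero. *)
Lemma exprD1_widen (R : comNzRingType) (n N : nat) (v : R) : (n <= N)%N ->
  (1 + v) ^+ n = \sum_(0 <= j < N.+1) 'C(n, j)%:R * v ^+ j.
Proof.
move=> nN; rewrite (big_cat_nat (n := n.+1)) //=.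
rewrite [X in _ = _ + X]big_nat_cond [X in _ = _ + X]big1 ?addr0.
  rewrite big_mkord addrC exprD1n; apply: eq_bigr => i _.
  by rewrite mulr_natl.
by move=> j; rewrite andbT => /andP[nj _]; rewrite bin_small ?mul0r.
Qed.

Lemma odd_bin_sum (R : comNzRingType) (n M : nat) (v : R) : (n <= M.*2)%N ->
  (1 + v) ^+ n - (1 - v) ^+ n =
  2 * \sum_(1 <= k < M.+1) 'C(n, k.*2.-1)%:R * v ^+ k.*2.-1.
Proof.
(* Once the sums are widened, the bound on n is dropped and the induction on M keeps n fixed. Each
   step adds the indices 2M+1, which doubles, and 2M+2, which cancels. *)
move=> nM; rewrite !(exprD1_widen _ _ _ _ nM) -sumrB {nM}.
elim: M => [|M IHM].
  by rewrite big_nat1 [in RHS]big_geq // !expr0 subrr mulr0.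
rewrite (big_nat_recr M.+1) // mulrDr -IHM doubleS 2?big_nat_recr //= -addrA.
congr (_ + _); rewrite -2!mulrBr !(exprNn v).
rewrite -(signr_odd _ M.*2.+1) -(signr_odd _ M.*2.+2) /= odd_double /=.
by rewrite expr0 expr1 mul1r subrr mulr0 addr0; ring.
Qed.

(** * The two sums in characteristic p *)

Lemma pchar_odd2 {K : fieldType} {n : nat} : n.*2.+1 \in [pchar K] -> 2 != 0 :> K.
Proof.
by move=> pK; rewrite -(dvdn_pcharf pK) dvdn_prime2 ?(pcharf_prime pK) //; lia.
Qed.

(** Factoring out w^n leaves twice the odd part of (1+v)^n with v = 1/w. Its coefficient C(n,2k-1)
    is C(4k-2,2k-1) divided by (-4)^(2k-1), that is by -4 times 16^(k-1). *)
Lemma central_bin_sum {K : fieldType} {n : nat} (w : K) :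
  n.*2.+1 \in [pchar K] -> w != 0 ->
  - 8 * (\sum_(1 <= k < (n.*2.+2 %/ 4).+1)
           'C(4 * k - 2, 2 * k - 1)%:R / (16 * w ^+ 2) ^+ k) * w ^+ n.+1 =
  (w + 1) ^+ n - (w - 1) ^+ n.
Proof.
move=> pK w0; have two0 := pchar_odd2 pK.
(* M = [(n+1)/2] is large enough to reach every odd index up to n and small enough that 2k-1 <= n
   throughout. *)
set M := (_ %/ 4)%N; have nM : (n <= M.*2)%N by rewrite /M; lia.
have wE (x : K) : w + x = w * (1 + x * w^-1).
  by rewrite mulrDr mulr1 mulrCA divff // mulr1.
rewrite !wE mul1r mulN1r !exprMn -mulrBr (odd_bin_sum _ _ M) //.
rewrite !mulr_sumr mulr_suml; apply: eq_big_nat => k /andP[k0 kM].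
case: k k0 kM => // k _ kM.
have -> : (4 * k.+1 - 2 = k.*2.+1.*2)%N by lia.
have -> : (2 * k.+1 - 1 = k.*2.+1)%N by lia.
rewrite (central_bin_pchar _ pK); last by rewrite /M in kM; lia.
have e16 : (-4) ^+ k.*2.+1 = - 4 * 16 ^+ k :> K.
  by rewrite exprS -mul2n exprM; congr (_ * _ ^+ _); ring.
have ew : (w ^+ 2) ^+ k.+1 = w * w ^+ k.*2.+1.
  by rewrite -exprM -exprS; congr (_ ^+ _); lia.
have c0 : 16 != 0 :> K by rewrite (_ : 16 = 2 ^+ 4 :> K) ?expf_neq0 //; ring.
have s0 : 16 ^+ k != 0 :> K by rewrite expf_neq0.
have b0 : w ^+ k.*2.+1 != 0 by rewrite expf_neq0.
rewrite doubleS /= exprMn ew e16 exprVn [16 ^+ k.+1]exprS [w ^+ n.+1]exprS.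
move: (w ^+ k.*2.+1) (16 ^+ k) (w ^+ n) s0 b0 => x y z y0 x0.
by field; rewrite x0 y0 w0 c0.
Qed.

(** Replace k by k+n: as 2(k+n) = p + (2k-1), each binomial becomes 2 C(4k-2,2k-1), while (16D)^n =
    D^n because 16^n = 1. The bounds match since [3p/4] - n = [(p+1)/4]. *)
Lemma central_bin_sum_shift {K : fieldType} {n : nat} (D : K) :
  n.*2.+1 \in [pchar K] -> D != 0 ->
  D ^+ n * \sum_(n.+1 <= k < (3 * n.*2.+1) %/ 4 + 1)
             'C(4 * k, 2 * k)%:R / (16 * D) ^+ k =
  2 * \sum_(1 <= k < (n.*2.+2 %/ 4).+1)
             'C(4 * k - 2, 2 * k - 1)%:R / (16 * D) ^+ k.
Proof.
move=> pK D0; have two0 := pchar_odd2 pK.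
have -> : ((3 * n.*2.+1) %/ 4 + 1 = (n.*2.+2 %/ 4).+1 + n)%N by lia.
rewrite -add1n big_addn addnK !mulr_sumr; apply: eq_big_nat => k /andP[k0 kM].
have -> : (4 * (k + n) = (n.*2.+1 + (2 * k - 1)).*2)%N by lia.
have -> : (2 * (k + n) = n.*2.+1 + (2 * k - 1))%N by lia.
rewrite (central_bin_shift _ pK); last by lia.
have -> : ((2 * k - 1).*2 = 4 * k - 2)%N by lia.
have e16 : 16 ^+ n = 1 :> K.
  rewrite (_ : 16 = (2 * 2) * (2 * 2) :> K); last by ring.
  have two_p : 2 ^+ n.*2.+1 = 2 :> K by exact: (exprp_int 2 pK).
  by rewrite !exprMn !(expr_pred_p _ two_p two0) mulr1.
rewrite exprD [(16 * D) ^+ n]exprMn e16 mul1r.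
have D16 : (16 * D) ^+ k != 0.
  rewrite expf_neq0 // mulf_neq0 // (_ : 16 = 2 ^+ 4 :> K) ?expf_neq0 //; ring.
have Dn0 : D ^+ n != 0 by rewrite expf_neq0.
by field; rewrite D16.
Qed.

(** * Evaluation for c^2+1 a residue, then a nonresidue *)

Lemma residue_sum_eq0 {K : fieldType} {n : nat} (c w : K) :
  n.*2.+1 \in [pchar K] -> c != 0 -> c ^+ n.*2.+1 = c ->
  w ^+ 2 = c ^+ 2 + 1 -> w ^+ n.*2.+1 = w ->
  (w + 1) ^+ n - (w - 1) ^+ n = 0.
Proof.
move=> pK c0 cp w2 wp; have two0 := pchar_odd2 pK.
have prod_c : (w + 1) * (w - 1) = c * c.
  transitivity (w ^+ 2 - 1); first by ring.
  by rewrite w2; ring.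
have /andP[wp0 wm0] : (w + 1 != 0) && (w - 1 != 0).
  by rewrite -negb_or -mulf_eq0 prod_c mulf_neq0.
have wp1 : (w + 1) ^+ n.*2.+1 = w + 1 by rewrite (exprDp _ _ pK) wp expr1n.
have A2 := expr_pred_p _ wp1 wp0.
have : (w + 1) ^+ n * (w - 1) ^+ n = 1.
  by rewrite -exprMn prod_c exprMn (expr_pred_p _ cp c0).
(* (w+1)^n has product 1 both with itself and with (w-1)^n, so the two powers agree. *)
by rewrite -[X in _ = X]A2 => /mulfI eqB; rewrite eqB ?subrr ?expf_neq0.
Qed.

(** With A = (w+1)^n and B = (w-1)^n, AB = c^(2n) = 1 and (w+1)A^2 = (w+1)^p = 1-w. Multiplying the
    hypothesis on S by (w+1)A therefore eliminates both powers on its right side. *)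
Lemma nonresidue_sum {K : fieldType} {n : nat} (c w S : K) :
  n.*2.+1 \in [pchar K] -> c != 0 -> c ^+ n.*2.+1 = c ->
  w != 0 -> w ^+ 2 = c ^+ 2 + 1 -> w ^+ n.*2.+1 = - w ->
  2 * w ^+ n.+1 * S = c * ((w + 1) ^+ n - (w - 1) ^+ n) ->
  S * w ^+ n * (1 + w) ^+ n.+1 = - c.
Proof.
move=> pK c0 cp w0 w2 wp SE; have two0 := pchar_odd2 pK.
have prod_c : (w + 1) * (w - 1) = c * c.
  transitivity (w ^+ 2 - 1); first by ring.
  by rewrite w2; ring.
have AB : (w + 1) ^+ n * (w - 1) ^+ n = 1.
  by rewrite -exprMn prod_c exprMn (expr_pred_p _ cp c0).
have A2 : (w + 1) * ((w + 1) ^+ n * (w + 1) ^+ n) = 1 - w.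
  by rewrite -exprD addnn -exprS (exprDp _ _ pK) wp expr1n addrC.
apply: (mulfI (mulf_neq0 two0 w0)).
rewrite -[1 + w]addrC exprS.
move: SE; rewrite exprS => SE.
transitivity ((2 * (w * w ^+ n) * S) * ((w + 1) * (w + 1) ^+ n)); first by ring.
rewrite {}SE.
transitivity (c * ((w + 1) * ((w + 1) ^+ n * (w + 1) ^+ n) -
    (w + 1) * ((w + 1) ^+ n * (w - 1) ^+ n))); first by ring.
by rewrite A2 AB; ring.
Qed.

Lemma sqrtN1_frob {K : fieldType} (n : nat) {t : K} :
  t ^+ 2 = -1 -> t ^+ n.*2.+1 = (-1) ^+ odd n * t.
Proof. by move=> t2; rewrite exprS -mul2n exprM t2 signr_odd mulrC. Qed.

Lemma sqrtN1_odd {K : fieldType} {r : nat} {t : K} :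
  odd r -> t ^+ 2 = -1 -> t ^+ r * t ^+ r = -1.
Proof. by move=> r1 t2; rewrite -expr2 exprAC t2 -signr_odd r1. Qed.

(** The exponent n(n+1) is (p^2-1)/4. The hypothesis forces p = 3 mod 4, so Frobenius sends z = c+t
    to c-t. *)
Lemma inert_sum {K : fieldType} {n r : nat} (c t : K) :
  n.*2.+1 \in [pchar K] -> odd r -> c != 0 -> c ^+ n.*2.+1 = c ->
  t ^+ 2 = -1 -> c ^+ 2 + 1 != 0 ->
  (c + t) ^+ (n * n.+1) = t ^+ r ->
  exists2 w, w ^+ 2 = c ^+ 2 + 1 & forall S,
  2 * w ^+ n.+1 * S = c * ((w + 1) ^+ n - (w - 1) ^+ n) -> S = - t ^+ r.+1.
Proof.
move=> pK r1 c0 cp t2 D0 zN; have two0 := pchar_odd2 pK.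
have t2r := sqrtN1_odd r1 t2; have tp := sqrtN1_frob n t2.
have t0 : t != 0.
  by apply: contraNneq (oner_neq0 K) => t0; rewrite -oppr_eq0 -t2 t0 expr0n.
have DE : (c + t) * (c - t) = c ^+ 2 + 1.
  transitivity (c ^+ 2 - t ^+ 2); first by ring.
  by rewrite t2 opprK.
have z0 : c + t != 0 by apply: contraNneq D0 => z0; rewrite -DE z0 mul0r.
(* For n even, z lies in F_p, so z^(n(n+1)) squares to 1 and cannot be t^r. *)
case: (boolP (odd n)) tp => [n1|n0] tp; last first.
  have zp : (c + t) ^+ n.*2.+1 = c + t by rewrite (exprDp _ _ pK) cp tp expr0 mul1r.
  move: t2r; rewrite -zN exprM -exprMn (expr_pred_p _ zp z0) expr1n => /eqP.
  by rewrite -subr_eq0 opprK -[1 + 1]/(2 : K) (negPf two0).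
have tp' : t ^+ n.*2.+1 = - t by rewrite tp expr1 mulN1r.
have zp : (c + t) ^+ n.*2.+1 = c - t by rewrite (exprDp _ _ pK) cp tp'.
(* This square root of z z^p = D is chosen because its n-th power is the given t^r; hence D^n =
   t^(2r) = -1. *)
set w := (c + t) ^+ n.+1.
have w2 : w ^+ 2 = c ^+ 2 + 1.
  by rewrite -DE -zp -exprM -exprS; congr (_ ^+ _); lia.
have wn : w ^+ n = t ^+ r by rewrite -exprM mulnC.
have Dn : (c ^+ 2 + 1) ^+ n = -1 by rewrite -w2 exprAC wn expr2.
have wp : w ^+ n.*2.+1 = - w by rewrite exprS -mul2n exprM w2 Dn mulrN1.
have w0 : w != 0 by rewrite expf_neq0.
exists w => // S SE.
have := nonresidue_sum _ _ _ pK c0 cp w0 w2 wp SE; rewrite wn.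
(* 2t = (1+t)^2, and Frobenius sends 1+t to 1-t = -t(1+t). *)
have t2n : (2 * t) ^+ n = - t.
  have t1 : 1 + t != 0.
    apply: contraNneq two0 => t1; apply/eqP.
    transitivity (1 - t ^+ 2); first by rewrite t2; ring.
    by transitivity ((1 + t) * (1 - t)); [ring | rewrite t1 mul0r].
  apply: (mulfI t1); have -> : 2 * t = (1 + t) ^+ 2 by rewrite sqrrD t2; ring.
  rewrite -exprM mul2n -exprS (exprDp _ _ pK) tp' expr1n mulrN mulrDl.
  by rewrite mul1r -expr2 t2; ring.
have sE : 2 * t * (1 + w) * (c + t) = ((c + t) + t * w) ^+ 2.
  have -> : 2 * t * (1 + w) * (c + t) =
    (c + t) ^+ 2 - (c + t) * (c - t) + 2 * t * w * (c + t) by ring.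
  by rewrite DE -w2 [RHS]sqrrD exprMn t2; ring.
(* The square raised to n+1 is a power p+1, hence the product of z+tw and its Frobenius image
   (c-t)+tw, where t and w both change sign. *)
have : (2 * t * (1 + w) * (c + t)) ^+ n.+1 = 2 * c * t * w.
  rewrite sE -exprM (_ : (2 * n.+1 = n.*2.+1.+1)%N) ?exprS; last by lia.
  rewrite -exprS (exprDp _ _ pK) zp exprMn wp tp' mulrNN.
  have -> : (c + t + t * w) * (c - t + t * w) =
    (c + t) * (c - t) + t ^+ 2 * w ^+ 2 + 2 * c * t * w by ring.
  by rewrite DE -w2 t2; ring.
rewrite exprMn -/w => /(mulIf w0); rewrite exprMn exprS t2n => E1 E2.
have W : t * (1 + w) ^+ n.+1 = - c.
  apply: (mulfI (mulf_neq0 two0 t0)).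
  by apply: oppr_inj; rewrite mulrN opprK [RHS]mulrAC -E1; ring.
apply: (mulfI c0).
(* This product is cS by [W] and t^(2r) = -1, and it is -c t^(r+1) by [E2]. *)
transitivity (t * (S * t ^+ r * (1 + w) ^+ n.+1) * t ^+ r).
  transitivity (S * (t ^+ r * t ^+ r) * (t * (1 + w) ^+ n.+1)); last by ring.
  by rewrite t2r W; ring.
by rewrite E2 exprS; ring.
Qed.

(** Here p = 4m+1, so t, z = c+t and z' = c-t are fixed by Frobenius, and (z/z')^m = t^r is the
    quartic character. As r is odd, z^n = -z'^n and D^n = -1. Any square root w of D serves, since
    w^n = D^m = z^m z'^m. *)
Lemma split_sum {K : fieldType} {m r : nat} (c t w S : K) :
  let n := m.*2 in
  n.*2.+1 \in [pchar K] -> odd r -> c != 0 -> c ^+ n.*2.+1 = c ->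
  t ^+ 2 = -1 -> c ^+ 2 + 1 != 0 ->
  (c + t) ^+ m = t ^+ r * (c - t) ^+ m ->
  w ^+ 2 = c ^+ 2 + 1 ->
  2 * w ^+ n.+1 * S = c * ((w + 1) ^+ n - (w - 1) ^+ n) -> S = - t ^+ r.+1.
Proof.
move=> n pK r1 c0 cp t2 D0 zm w2 SE; have two0 := pchar_odd2 pK.
have t2r := sqrtN1_odd r1 t2.
have tp : t ^+ n.*2.+1 = t by rewrite (sqrtN1_frob _ t2) /n odd_double mul1r.
have DE : (c + t) * (c - t) = c ^+ 2 + 1.
  transitivity (c ^+ 2 - t ^+ 2); first by ring.
  by rewrite t2 opprK.
have /andP[z0 z'0] : (c + t != 0) && (c - t != 0) by rewrite -negb_or -mulf_eq0 DE.
have zp : (c + t) ^+ n.*2.+1 = c + t by rewrite (exprDp _ _ pK) cp tp.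
have zn2 := expr_pred_p _ zp z0.
have nE (x : K) : x ^+ n = x ^+ m * x ^+ m by rewrite /n -addnn exprD.
have znE : (c + t) ^+ n = - (c - t) ^+ n.
  by rewrite !nE zm mulrACA t2r mulN1r.
have Dn : (c ^+ 2 + 1) ^+ n = -1.
  by rewrite -DE exprMn -[(c - t) ^+ n]opprK -znE mulrN zn2.
have wn : w ^+ n = (c + t) ^+ m * (c - t) ^+ m.
  by rewrite /n -mul2n exprM w2 -DE exprMn.
have wp : w ^+ n.*2.+1 = - w by rewrite exprS -mul2n exprM w2 Dn mulrN1.
have w0 : w != 0 by apply: contraNneq D0 => w0; rewrite -w2 w0 expr0n.
have := nonresidue_sum _ _ _ pK c0 cp w0 w2 wp SE; rewrite wn => E2.
have t2n : (2 * t) ^+ n = 1.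
  have t1 : 1 + t != 0.
    apply: contraNneq two0 => t1; apply/eqP.
    transitivity (1 - t ^+ 2); first by rewrite t2; ring.
    by transitivity ((1 + t) * (1 - t)); [ring | rewrite t1 mul0r].
  have t1p : (1 + t) ^+ n.*2.+1 = 1 + t by rewrite (exprDp _ _ pK) tp expr1n.
  have -> : 2 * t = (1 + t) ^+ 2 by rewrite sqrrD t2; ring.
  by rewrite exprAC expr2 (expr_pred_p _ t1p t1).
have sE : 2 * t * (1 + w) * (c + t) = ((c + t) + t * w) ^+ 2.
  have -> : 2 * t * (1 + w) * (c + t) =
    (c + t) ^+ 2 - (c + t) * (c - t) + 2 * t * w * (c + t) by ring.
  by rewrite DE -w2 [RHS]sqrrD exprMn t2; ring.
(* Frobenius now fixes z and t but negates w, so the power is (z+tw)(z-tw) = z^2 + zz' = 2cz. *)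
have : (2 * t * (1 + w) * (c + t)) ^+ n.+1 = 2 * c * (c + t).
  rewrite sE -exprM (_ : (2 * n.+1 = n.*2.+1.+1)%N) ?exprS; last by lia.
  rewrite -exprS (exprDp _ _ pK) zp exprMn wp tp mulrN.
  have -> : (c + t + t * w) * (c + t - t * w) = (c + t) ^+ 2 - t ^+ 2 * w ^+ 2 by ring.
  by rewrite t2 w2 -DE; ring.
rewrite exprMn [(c + t) ^+ n.+1]exprSr mulrA => /(mulIf z0).
rewrite exprMn exprS t2n mulr1 => E1.
have W : t * (1 + w) ^+ n.+1 = c * (c + t) ^+ n.
  apply: (mulfI two0).
  transitivity (2 * t * (1 + w) ^+ n.+1 * (c + t) ^+ n * (c + t) ^+ n).
    by rewrite -[RHS]mulrA zn2; ring.
  by rewrite E1; ring.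
apply: (mulfI c0).
have zm4 : (c + t) ^+ m * (c + t) ^+ m * (c + t) ^+ n = 1 by rewrite -nE zn2.
transitivity (S * (t ^+ r * (c - t) ^+ m) * (c + t) ^+ m * (c * (c + t) ^+ n)).
  rewrite -zm; transitivity (c * S * ((c + t) ^+ m * (c + t) ^+ m * (c + t) ^+ n)).
    by rewrite zm4 mulr1.
  by ring.
rewrite -W.
transitivity (t ^+ r * t * (S * ((c + t) ^+ m * (c - t) ^+ m) * (1 + w) ^+ n.+1)).
  by ring.
by rewrite E2 exprS; ring.
Qed.

(** * Gaussian integers evaluated in [K] *)

(* The graph of the ring morphism a + bi |-> a + tb, for t^2 = -1. *)
Definition gauss_image {K : fieldType} (t : K) (x : algC) (y : K) : Prop :=
  exists a b : int, x = a%:~R + 'i * b%:~R /\ y = a%:~R + t * b%:~R.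

(** The norm a^2+b^2 vanishes, so a = b = 0. Together with additivity this makes the relation
    single-valued. *)
Lemma gauss_image0_eq0 {K : fieldType} {t y : K} : gauss_image t 0 y -> y = 0.
Proof.
move=> [a [b [ab0 ->]]].
have : a * a + b * b = 0.
  apply: (@intr_inj algC); rewrite intrD !intrM.
  transitivity ((a%:~R + 'i * b%:~R) * (a%:~R - 'i * b%:~R) +
    (1 + 'i ^+ 2) * (b%:~R * b%:~R) : algC).
    by ring.
  by rewrite -ab0 mul0r sqrCi subrr mul0r addr0.
move=> ab.
have [-> ->] : a = 0 /\ b = 0 by nia.
by rewrite mulr0 addr0.
Qed.

Lemma gauss_imageB {K : fieldType} {t : K} {x x' y y'} :
  gauss_image t x y -> gauss_image t x' y' -> gauss_image t (x - x') (y - y').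
Proof.
move=> [a [b [-> ->]]] [a' [b' [-> ->]]]; exists (a - a'), (b - b').
by rewrite !rmorphB; split; ring.
Qed.

Lemma gauss_imageM {K : fieldType} {t : K} {x x' y y'} : t ^+ 2 = -1 ->
  gauss_image t x y -> gauss_image t x' y' -> gauss_image t (x * x') (y * y').
Proof.
move=> t2 [a [b [-> ->]]] [a' [b' [-> ->]]].
exists (a * a' - b * b'), (a * b' + b * a').
rewrite rmorphB rmorphD !rmorphM /= rmorphB rmorphD !rmorphM /=; split.
  transitivity (a%:~R * a'%:~R + 'i ^+ 2 * (b%:~R * b'%:~R) +
    'i * (a%:~R * b'%:~R + b%:~R * a'%:~R) : algC); first by ring.
  by rewrite sqrCi mulN1r.
transitivity (a%:~R * a'%:~R + t ^+ 2 * (b%:~R * b'%:~R) +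
    t * (a%:~R * b'%:~R + b%:~R * a'%:~R)); first by ring.
by rewrite t2 mulN1r.
Qed.

Lemma gauss_image_inj {K : fieldType} {t : K} {x y y'} :
  gauss_image t x y -> gauss_image t x y' -> y = y'.
Proof.
move=> xy xy'; apply/eqP; rewrite -subr_eq0; apply/eqP.
by have := gauss_imageB xy xy'; rewrite subrr => /gauss_image0_eq0.
Qed.

Lemma gauss_image1 {K : fieldType} (t : K) : gauss_image t 1 1.
Proof. by exists 1, 0; rewrite !mulr0 !addr0. Qed.

Lemma gauss_imageX {K : fieldType} {t : K} {x y} n : t ^+ 2 = -1 ->
  gauss_image t x y -> gauss_image t (x ^+ n) (y ^+ n).
Proof.
move=> t2 xy; elim: n => [|n IHn]; first exact: gauss_image1.
by rewrite !exprS; apply: gauss_imageM.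
Qed.

Lemma gauss_image_i {K : fieldType} (t : K) : gauss_image t 'i t.
Proof. by exists 0, 1; rewrite !mulr1 !add0r. Qed.

Lemma gauss_gauss_image {K : fieldType} (t : K) x :
  gauss x -> exists y, gauss_image t x y.
Proof. by move=> [a [b ->]]; exists (a%:~R + t * b%:~R), a, b. Qed.

(** When q is sent to 0, so is every Gaussian multiple of q, in particular x - x'. *)
Lemma gcong_image {K : fieldType} {t : K} {x x' q y y'} : t ^+ 2 = -1 ->
  gcong x x' q -> gauss_image t q 0 ->
  gauss_image t x y -> gauss_image t x' y' -> y = y'.
Proof.
move=> t2 [g [/(gauss_gauss_image t)[h gh] eq_q]] q0 xy xy'.
have := gauss_imageB xy xy'; rewrite eq_q => e1.
have := gauss_image_inj e1 (gauss_imageM t2 gh q0).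
by rewrite mulr0 => /eqP; rewrite subr_eq0 => /eqP.
Qed.

(** * Norms, the factorization of p and the quartic symbol *)

Lemma conj_gauss (a b : int) :
  (a%:~R + 'i * b%:~R)^* = a%:~R - 'i * b%:~R :> algC.
Proof. by rewrite rmorphD rmorphM /= conjCi !rmorph_int mulNr. Qed.

Lemma gauss_norm_int (a b : int) :
  (a%:~R + 'i * b%:~R) * (a%:~R + 'i * b%:~R)^* = (a * a + b * b)%:~R :> algC.
Proof.
rewrite conj_gauss intrD !intrM.
transitivity (a%:~R * a%:~R - 'i ^+ 2 * (b%:~R * b%:~R) : algC); first by ring.
by rewrite sqrCi mulN1r opprK.
Qed.

(** Norm 1 would make the conjugate an inverse, and norm 0 would make q zero. *)
Lemma gprime_norm_gt1 {q : algC} {N : nat} : gprime q -> q * q^* = N%:R -> (1 < N)%N.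
Proof.
move=> [[a [b qE]] q0 q_nunit _] qN; rewrite ltn_neqAle lt0n.
apply/andP; split; apply/eqP => N0.
  apply: q_nunit; split; first by exists a, b.
  exists q^*; split; last by rewrite mulrC qN -N0.
  by exists a, (- b); rewrite qE conj_gauss rmorphN mulrN.
move/eqP: qN; rewrite N0 mulf_eq0 fmorph_eq0 orbb => /eqP.
exact: q0.
Qed.

(** Norms multiply and each exceeds 1. This serves to rule out a third prime factor of p. *)
Lemma gprime_prod_norm (s : seq (algC * algC)) :
  (forall x, x \in s -> gprime x.1 /\ exists N : nat, x.1 * x.1^* = N%:R) ->
  exists M : nat, [/\ (\prod_(x <- s) x.1) * (\prod_(x <- s) x.1)^* = M%:R,
    (0 < M)%N & M = 1%N -> s = [::]].
Proof.
elim: s => [|x s IHs] s_prime; first by exists 1%N; rewrite big_nil rmorph1 mulr1.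
have [x_prime [N xN]] := s_prime x (mem_head _ _).
have [y ys|M [sM M0 _]] := IHs; first by apply: s_prime; rewrite inE ys orbT.
have N1 := gprime_norm_gt1 x_prime xN.
exists (N * M)%N; rewrite big_cons rmorphM /= mulrACA xN sM -natrM; split=> //; nia.
Qed.

Lemma prime_square_factors {p a b m : nat} : prime p -> (1 < a)%N -> (1 < b)%N ->
  (a * (b * m) = p ^ 2)%N -> [/\ a = p, b = p & m = 1%N].
Proof.
move=> p_pr a1 b1 e.
have pfac d : (d %| p ^ 2)%N -> exists k, d = (p ^ k)%N.
  by move=> /(dvdn_pfactor _ _ p_pr)[k _ ->]; exists k.
have [k ak] : exists k, a = (p ^ k)%N by apply: pfac; rewrite -e dvdn_mulr.
have [l bl] : exists k, b = (p ^ k)%N by apply: pfac; rewrite -e dvdn_mull ?dvdn_mulr.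
have [j mj] : exists k, m = (p ^ k)%N by apply: pfac; rewrite -e !dvdn_mull.
move: e; rewrite ak bl mj -!expnD => /eqP; rewrite eqn_exp2l ?prime_gt1 // => /eqP e.
have k0 : (0 < k)%N by case: k ak {e} => // a_; rewrite a_ in a1.
have l0 : (0 < l)%N by case: l bl {e} => // b_; rewrite b_ in b1.
have [-> -> ->] : [/\ k = 1, l = 1 & j = 0]%N by split; lia.
by [].
Qed.

Lemma quartic_unit {u : algC} : u \in [:: 0; 1; 'i; -1; - 'i] -> u != 0 ->
  exists2 ab : int * int, u = ab.1%:~R + 'i * ab.2%:~R & ab.1 * ab.1 + ab.2 * ab.2 = 1.
Proof.
rewrite !inE => /or4P[/eqP->|/eqP->|/eqP->|/orP[]/eqP->]; rewrite ?eqxx // => _.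
- by exists (1, 0); rewrite /= ?mulr0 ?addr0.
- by exists (0, 1); rewrite /= ?mulr1 ?add0r.
- by exists (-1, 0); rewrite /= ?mulr0 ?addr0.
- by exists (0, -1); rewrite /= ?mulrN ?mulr1 ?add0r.
Qed.

(** Sending i to t in the first congruence gives (a+tb)^m = u1(t); sending i to -t in the second
    gives (a-tb)^m = u2(-t). Moreover u1(t) u2(t) = t^r, and u2(t) u2(-t) is the norm of a unit, so
    it equals 1. *)
Lemma conjugate_symbols {K : fieldType} {t : K} (a b : int) (m r : nat)
    (q1 q2 u1 u2 : algC) :
  t ^+ 2 = -1 -> gauss_image t q1 0 -> gauss_image (- t) q2 0 ->
  u1 \in [:: 0; 1; 'i; -1; - 'i] -> u2 \in [:: 0; 1; 'i; -1; - 'i] ->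
  u1 * u2 = 'i ^+ r ->
  gcong ((a%:~R + 'i * b%:~R) ^+ m) u1 q1 ->
  gcong ((a%:~R + 'i * b%:~R) ^+ m) u2 q2 ->
  (a%:~R + t * b%:~R) ^+ m = t ^+ r * (a%:~R - t * b%:~R) ^+ m.
Proof.
move=> t2 q1_0 q2_0 u1_in u2_in u12 cong1 cong2.
have t2N : (- t) ^+ 2 = -1 by rewrite sqrrN.
have /andP[u10 u20] : (u1 != 0) && (u2 != 0).
  by rewrite -negb_or -mulf_eq0 u12 expf_neq0 // neq0Ci.
have [[x1 y1] /= u1E _] := quartic_unit u1_in u10.
have [[x2 y2] /= u2E u2N] := quartic_unit u2_in u20.
have im (s : K) : gauss_image s (a%:~R + 'i * b%:~R) (a%:~R + s * b%:~R) by exists a, b.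
have im1 (s : K) : gauss_image s u1 (x1%:~R + s * y1%:~R) by exists x1, y1.
have im2 (s : K) : gauss_image s u2 (x2%:~R + s * y2%:~R) by exists x2, y2.
have e1 := gcong_image t2 cong1 q1_0 (gauss_imageX m t2 (im t)) (im1 t).
have := gcong_image t2N cong2 q2_0 (gauss_imageX m t2N (im (- t))) (im2 (- t)).
rewrite mulNr => e2.
have e12 : (x1%:~R + t * y1%:~R) * (x2%:~R + t * y2%:~R) = t ^+ r.
  apply: (gauss_image_inj (t := t) (x := u1 * u2)); first exact: gauss_imageM.
  by rewrite u12; apply: gauss_imageX => //; apply: gauss_image_i.
rewrite e1 e2 -e12 -mulrA.
have -> : (x2%:~R + t * y2%:~R) * (x2%:~R + - t * y2%:~R) = 1.
  transitivity ((x2 * x2 + y2 * y2)%:~R : K); last by rewrite u2N.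
  rewrite intrD !intrM; transitivity (x2%:~R * x2%:~R - t ^+ 2 * (y2%:~R * y2%:~R)).
    by ring.
  by rewrite t2 mulN1r opprK.
by rewrite mulr1.
Qed.

Lemma sum_two_squares_mod4 {p : nat} {x y : int} :
  odd p -> x * x + y * y = p%:Z -> (p %% 4 = 1)%N.
Proof.
have square_mod4 (z : int) : exists k : int, z * z = 4 * k \/ z * z = 4 * k + 1.
  have [h [->|->]] : exists h : int, z = 2 * h \/ z = 2 * h + 1.
    by exists (z %/ 2)%Z; lia.
  - by exists (h * h); left; ring.
  - by exists (h * h + h); right; ring.
by have [k [->|->]] := square_mod4 x; have [l [->|->]] := square_mod4 y; lia.
Qed.

(** The norms of the prime factors multiply to p^2. A single factor is p itself, of norm p^2;
    otherwise there are two conjugate factors of norm p, and only the product of their symbols is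
    given, whence a relation between two powers. *)
Lemma qsym_cases {K : fieldType} {p r : nat} {t : K} (a b : int) :
  p \in [pchar K] -> odd p -> t ^+ 2 = -1 ->
  qsym p (a%:~R + 'i * b%:~R) ('i ^+ r) ->
  (a%:~R + t * b%:~R) ^+ ((p ^ 2 - 1) %/ 4) = t ^+ r \/
  (p %% 4 = 1)%N /\ (a%:~R + t * b%:~R) ^+ ((p - 1) %/ 4) =
    t ^+ r * (a%:~R - t * b%:~R) ^+ ((p - 1) %/ 4).
Proof.
move=> pK p_odd t2 [s [s_prime prod_p prod_u]].
have p_pr := pcharf_prime pK.
have pK0 : p%:R = 0 :> K by apply/eqP; rewrite -(dvdn_pcharf pK).
have normed x : x \in s -> gprime x.1 /\ exists N : nat, x.1 * x.1^* = N%:R.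
  by move=> /s_prime[gx [N [xN _]]]; split=> //; exists N.
case: s => [|[q1 u1] [|[q2 u2] s]] in s_prime prod_p prod_u normed *.
- move/eqP: prod_p; rewrite big_nil eq_sym (eqr_nat _ p 1) => /eqP p1.
  by rewrite p1 in p_pr.
- left; move: prod_p prod_u; rewrite !big_seq1 /= => qE uE.
  have [_ [N [/= qN [_ cong]]]] := s_prime _ (mem_head _ _).
  have NE : N = (p ^ 2)%N.
    by apply/eqP; rewrite -(eqr_nat algC) -qN qE rmorph_nat natrX expr2.
  rewrite qE uE NE in cong.
  apply: (gcong_image t2 cong); last by apply: gauss_imageX => //; apply: gauss_image_i.
    by exists p%:Z, 0; rewrite !mulr0 !addr0; split; last exact: (esym pK0).
  by apply: gauss_imageX => //; exists a, b.
right.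
have [q1_prime [N1 [/= q1N [u1_in cong1]]]] := s_prime (q1, u1) (mem_head _ _).
have q2_mem : (q2, u2) \in [:: (q1, u1), (q2, u2) & s] by rewrite !inE eqxx orbT.
have [q2_prime [N2 [/= q2N [u2_in cong2]]]] := s_prime _ q2_mem.
have [|M [sM _ M1]] := gprime_prod_norm s.
  by move=> x xs; apply: normed; rewrite !inE xs !orbT.
have NNM : (N1 * (N2 * M) = p ^ 2)%N.
  apply/eqP; rewrite -(eqr_nat algC) !natrM -q1N -q2N -sM.
  rewrite -{2}(rmorph_nat Num.conj p) -prod_p !big_cons /= !rmorphM /=.
  by apply/eqP; ring.
have [N1p N2p /M1 s0] :=
  prime_square_factors p_pr (gprime_norm_gt1 q1_prime q1N)
    (gprime_norm_gt1 q2_prime q2N) NNM.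
rewrite {}s0 {}N1p {}N2p {s_prime normed q2_mem NNM sM M1}
  in prod_p prod_u q1N q2N cong1 cong2 *.
rewrite !big_cons !big_nil /= !mulr1 in prod_p prod_u.
have [[x [y /= q1E]] q1_neq0 _ _] := q1_prime.
have q2E : q2 = x%:~R - 'i * y%:~R.
  rewrite -conj_gauss -q1E; apply: (mulfI (introN eqP q1_neq0)).
  by rewrite prod_p q1N.
have xyp : x * x + y * y = p%:Z.
  by apply: (@intr_inj algC); rewrite -gauss_norm_int -q1E q1N.
split; first exact: (sum_two_squares_mod4 p_odd xyp).
have : (x%:~R + t * y%:~R) * (x%:~R - t * y%:~R) == 0 :> K.
  rewrite (_ : _ * _ = x%:~R * x%:~R - t ^+ 2 * (y%:~R * y%:~R)); last by ring.
  by rewrite t2 mulN1r opprK -!intrM -intrD xyp -[p%:~R]/(p%:R) pK0.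
(* As p = 0 in [K], sending i to t kills one of the conjugate primes, and sending i to -t kills the
   other. *)
rewrite mulf_eq0 => /orP[/eqP q10 | /eqP q20].
  apply: (conjugate_symbols a b _ r q1 q2 u1 u2) => //; first by exists x, y.
  by exists x, (- y); rewrite q2E rmorphN mulrN rmorphN mulrNN q10.
apply: (conjugate_symbols a b _ r q2 q1 u2 u1) => //; last by rewrite mulrC.
  by exists x, (- y); rewrite q2E !rmorphN !mulrN q20.
by exists x, y; rewrite q1E mulNr q20.
Qed.

(** * Values of the sum and return to the rationals *)

Lemma closed_sqrt {K : closedFieldType} (x : K) : exists y, y ^+ 2 = x.
Proof.
have /closed_rootP[y] : size ('X^2 - x%:P) != 1%N by rewrite size_XnsubC.
by rewrite rootE !hornerE subr_eq0 => /eqP; exists y.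
Qed.

(** The single expression -t^(r+1) covers both nonresidue classes: it is 1 for r = 1 and -1 for r =
    3. *)
Lemma central_bin_sum_values {K : closedFieldType} {n : nat} (c t : K) :
  n.*2.+1 \in [pchar K] -> c != 0 -> c ^+ n.*2.+1 = c -> t ^+ 2 = -1 ->
  c ^+ 2 + 1 != 0 ->
  let S := - 4 * c * \sum_(1 <= k < (n.*2.+2 %/ 4).+1)
    'C(4 * k - 2, 2 * k - 1)%:R / (16 * (c ^+ 2 + 1)) ^+ k in
  let p := n.*2.+1 in
  ((c ^+ 2 + 1) ^+ n = 1 -> S = 0) /\
  (forall r, odd r ->
     (c + t) ^+ ((p ^ 2 - 1) %/ 4) = t ^+ r \/
     (p %% 4 = 1)%N /\
       (c + t) ^+ ((p - 1) %/ 4) = t ^+ r * (c - t) ^+ ((p - 1) %/ 4) ->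
     S = - t ^+ r.+1).
Proof.
move=> pK c0 cp t2 D0 S p; have two0 := pchar_odd2 pK.
have SE w : w ^+ 2 = c ^+ 2 + 1 ->
    2 * w ^+ n.+1 * S = c * ((w + 1) ^+ n - (w - 1) ^+ n).
  move=> w2; have w0 : w != 0 by apply: contraNneq D0 => w0; rewrite -w2 w0 expr0n.
  by rewrite -(central_bin_sum _ pK w0) w2 /S; ring.
split=> [Dn | r r1 [zN | [p1 zm]]].
- have [w w2] := closed_sqrt (c ^+ 2 + 1).
  have wp : w ^+ n.*2.+1 = w by rewrite exprS -mul2n exprM w2 Dn mulr1.
  have := SE w w2; rewrite (residue_sum_eq0 _ _ pK c0 cp w2 wp) mulr0 => /eqP.
  have w0 : w != 0 by apply: contraNneq D0 => w0; rewrite -w2 w0 expr0n.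
  by rewrite mulf_eq0 mulf_eq0 (negPf two0) expf_eq0 (negPf w0) andbF => /eqP.
- rewrite (_ : ((p ^ 2 - 1) %/ 4 = n * n.+1)%N) in zN; last first.
    by rewrite /p (_ : (n.*2.+1 ^ 2 - 1 = n * n.+1 * 4)%N) ?mulnK //; nia.
  have [w w2 wS] := inert_sum _ _ pK r1 c0 cp t2 D0 zN.
  exact/wS/SE.
have [m nm] : exists m, n = m.*2 by exists n./2; rewrite /p in p1; lia.
rewrite (_ : ((p - 1) %/ 4 = m)%N) in zm; last by rewrite /p; lia.
have [w w2] := closed_sqrt (c ^+ 2 + 1).
subst n.
exact: split_sum pK r1 c0 cp t2 D0 zm w2 (SE w w2).
Qed.

Lemma Fp_closure (p : nat) : prime p -> exists K : closedFieldType, p \in [pchar K].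
Proof.
move=> p_pr; have [K [FtoK _]] := countable_algebraic_closure 'F_p.
by exists K; rewrite (fmorph_pchar FtoK) pchar_Fp.
Qed.

Theorem theorem3p1 (p : nat) (c : rat) :
  prime p -> odd p -> in_Zp p c -> ~ ratcong p (c * (c ^+ 2 + 1)) 0 ->
  let S1 := 2 * c * \sum_((p.+1)./2 <= k < (3 * p) %/ 4 + 1)
              ('C(4 * k, 2 * k))%:R / (16 * (c ^+ 2 + 1)) ^+ k in
  let S2 := - 4 * c * \sum_(1 <= k < p.+1 %/ 4 + 1)
              ('C(4 * k - 2, 2 * k - 1))%:R / (16 * (c ^+ 2 + 1)) ^+ k in
  ratcong p S1 S2 /\
  (legendre_one p (c ^+ 2 + 1) -> ratcong p S2 0) /\
  (Qr p 1 c -> ratcong p S2 1) /\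
  (Qr p 3 c -> ratcong p S2 (-1)).
Proof.
move=> p_pr p_odd cZ cD_nz.
have [K pK] := Fp_closure p p_pr.
have [d cd] := reduces_inZp K p c pK cZ.
have Dd : reduces_to (c ^+ 2 + 1) (d ^+ 2 + 1).
  exact: reducesD (reducesX _ cd) (reduces_nat K 1).
have dp := exprp_reduces pK cd.
have /andP[d0 D0] : (d != 0) && (d ^+ 2 + 1 != 0).
  rewrite -negb_or -mulf_eq0; apply/eqP => dD0; apply: cD_nz.
  by apply/(ratcong_reduces pK (reducesM cd Dd) (reduces_nat K 0)).
have [t t2] := closed_sqrt (-1 : K).
have [n pn] : exists n, p = n.*2.+1 by exists p./2; lia.
subst p; have two0 := pchar_odd2 pK.
have D16 : 16 * (d ^+ 2 + 1) != 0.
  by rewrite mulf_neq0 // (_ : 16 = 2 ^+ 4 :> K) ?expf_neq0 //; ring.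
have red_sum (B : nat -> nat) (i j : nat) :
    reduces_to (\sum_(i <= k < j) (B k)%:R / (16 * (c ^+ 2 + 1)) ^+ k)
               (\sum_(i <= k < j) (B k)%:R / (16 * (d ^+ 2 + 1)) ^+ k).
  apply: reduces_sum => k; apply: reducesM (reduces_nat _ _) _.
  apply: reducesV; first by rewrite expf_neq0.
  exact/reducesX/reducesM/Dd/(reduces_nat K 16).
move=> S1 S2.
have rS1 := reducesM (reducesM (reduces_nat K 2) cd)
  (red_sum (fun k => 'C(4 * k, 2 * k)) n.+1 ((3 * n.*2.+1) %/ 4 + 1)%N).
have rS2 := reducesM (reducesM (reducesN (reduces_nat K 4)) cd)
  (red_sum (fun k => 'C(4 * k - 2, 2 * k - 1)) 1 (n.*2.+2 %/ 4).+1).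
have [] := central_bin_sum_values d t pK d0 dp t2 D0.
set T := (X in - 4 * d * X).
rewrite -[(- 4%:R)]/(- 4) in rS2 *.
move=> square_case quartic_case.
have S1E : S1 = 2%:R * c * \sum_(n.+1 <= k < (3 * n.*2.+1) %/ 4 + 1)
              ('C(4 * k, 2 * k))%:R / (16 * (c ^+ 2 + 1)) ^+ k.
  by rewrite /S1 -doubleS doubleK.
have S2E : S2 = - 4 * c * \sum_(1 <= k < (n.*2.+2 %/ 4).+1)
              ('C(4 * k - 2, 2 * k - 1))%:R / (16 * (c ^+ 2 + 1)) ^+ k.
  by rewrite /S2 addn1.
rewrite -S1E in rS1; rewrite -S2E in rS2.
have Dp := expr_pred_p _ (exprp_reduces pK Dd) D0.
have shift := central_bin_sum_shift _ pK D0.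
split; [|split].
- apply/(ratcong_reduces pK rS1 rS2).
  (* D^n is 1 or -1. In the first case both sums vanish; in the second the shift identity equates
     them without their value being known. *)
  have := Dp; rewrite -expr2 => /eqP; rewrite sqrf_eq1 => /orP[]/eqP Dn.
    move: shift; rewrite Dn mul1r => ->; rewrite square_case //.
    by transitivity (- (- 4 * d * T)); [rewrite /T; ring | rewrite square_case ?oppr0].
  move: shift; rewrite Dn mulN1r => /(canRL opprK) ->.
  by rewrite /T; ring.
- move=> [_ [y yD]]; apply/(ratcong_reduces pK rS2 (reduces_nat K 0)).
  apply: square_case.
  have := (ratcong_reduces pK (reducesX 2 (reduces_int K y)) Dd).1 yD => yd.
  (* Euler's criterion in the easy direction: D = y^2 gives D^n = y^(2n) = 1. *)
  rewrite -yd exprAC expr2; apply: expr_pred_p; first exact: exprp_int.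
  by apply: contraNneq D0 => y0; rewrite -yd y0 expr0n.
have quartic r : odd r -> Qr n.*2.+1 r c -> - 4 * d * T = - t ^+ r.+1.
  move=> r1 [a [b [ac b1 sym]]]; apply: quartic_case => //.
  have := (ratcong_reduces pK (reduces_int K a) cd).1 ac => <-.
  have := qsym_cases a b pK p_odd t2 sym.
  have /= -> := (ratcong_reduces pK (reduces_int K b) (reduces_nat K 1)).1 b1.
  by rewrite !mulr1.
split=> [/(quartic 1%N isT)|/(quartic 3%N isT)] SE.
  apply/(ratcong_reduces pK rS2 (reduces_nat K 1)).
  by rewrite [LHS]SE t2 opprK.
apply/(ratcong_reduces pK rS2 (reducesN (reduces_nat K 1))).
by rewrite [LHS]SE (exprM t 2 2) t2 -signr_odd expr0.
Qed.
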